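(* Let $A$ be an integral (transitive, unital) $\mathbb{Z}_+$-ring of finite rank $r>1$ with basis $\{b_i\}_{i\in I}$, and let $b=\sum_i m_ib_i\in A$ with integers $m_i\ge 0$ be a $\mathbb{Z}_+$-generator of $A$. Let $d=\mathrm{FPdim}(b)$ and $N=\mathrm{FPdim}(A)$. Then: (i) Let $\chi$ be the characteristic polynomial of (multiplication by) $b$ on $A$, and let $Q(z)=(z-d)^{-1}\chi(z)$. Then $Q(d)$ is a positive integer divisible by $N$. In particular, $Q(d)\ge N$. (ii) Let $s$ be the number of roots of $Q$ with positive imaginary part (counted with multiplicities). Then $$d\ge N^{\frac{1}{r-1}}\left(1-\frac{s+1}{r}\right)^{1-\frac{s}{r-1}}.$$ (iii) We have $$d\ge N^{\frac{1}{r-1}}\left(\frac{\lceil \frac{r-1}{2}\rceil}{r}\right)^{\frac{\lceil \frac{r-1}{2}\rceil}{r-1}}.$$ In particular, $d\ge \frac12 N^{\frac{1}{r-1}}$.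
   Context: A transitive unital $\mathbb{Z}_+$-ring of finite rank is a free finitely generated abelian group $A$ with a fixed basis $b_i$, $i\in I$ (the rank is $|I|$), and a unital associative ring structure such that $b_ib_j=\sum_k N_{ij}^k b_k$ with $N_{ij}^k\in\mathbb{Z}_{\ge 0}$, $b_0=1$ for some element $0\in I$, and for each $j,k$ there exists $i$ with $N_{ij}^k>0$. There is a unique ring homomorphism $\mathrm{FPdim}:A\to\mathbb{R}$ such that $d_i:=\mathrm{FPdim}(b_i)>0$ for all $i$. Let $N_i$ be the matrix with $(j,k)$-entry $N_{ij}^k$ (multiplication by $b_i$). The column vector $\mathbf{d}=(d_i)$ satisfies $N_i\mathbf{d}=d_i\mathbf{d}$ for all $i$, and there is a row vector $\mathbf{p}=(p_i)$ with all $p_i>0$, unique up to a positive scalar, such that $\mathbf{p}N_i=d_i\mathbf{p}$ for all $i$. The ring $A$ is called integral if $\mathrm{FPdim}$ takes values in $\mathbb{Z}$. In this case $\mathbf{p}$ is normalized canonically, so that the $p_i$ are positive integers with greatest common divisor $1$, and one sets $\mathrm{FPdim}(A):=\sum_i p_id_i$. An element $b=\sum_i m_ib_i$ with $m_i\ge 0$ is called a $\mathbb{Z}_+$-generator of $A$ if for some $n$ all coefficients (in the basis $b_i$) of $1+b+\dots+b^n$ are positive. *)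

(* Defs.v *)
From HB Require Import structures.
From mathcomp Require Import all_boot all_order all_algebra.
From mathcomp Require Import complex.
From mathcomp Require Import reals exp.

Set Implicit Arguments.
Unset Strict Implicit.
Unset Printing Implicit Defensive.

Import Order.TTheory GRing.Theory Num.Theory.

Local Open Scope ring_scope.

(* Transitive unital Z_+-ring structure of rank r on a ring A.  The fields
   [zcoord_sum] and [zcoordK] say that [zbasis] is a Z-basis of A with
   coordinate map [zcoord]; the structure constants N_{ij}^k are the
   coordinates of the products [zbasis i * zbasis j]. *)
Record zplus_ring (A : pzRingType) (r : nat) := ZPlusRing {
  zbasis : 'I_r -> A;
  zcoord : A -> 'I_r -> int;
  zone : 'I_r;
  zcoord_sum : forall x : A, x = \sum_i zbasis i *~ zcoord x i;
  zcoordK : forall (c : 'I_r -> int) (i : 'I_r),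
    zcoord (\sum_j zbasis j *~ c j) i = c i;
  zone1 : zbasis zone = 1;
  zstruct_ge0 : forall i j k : 'I_r, 0 <= zcoord (zbasis i * zbasis j) k;
  ztransitive : forall j k : 'I_r,
    exists i : 'I_r, 0 < zcoord (zbasis i * zbasis j) k
}.

(* Matrix of left multiplication by x; row j holds the coordinates of
   x * b_j, so for x = b_i the (j, k) entry is N_{ij}^k. *)
Definition zmulmx (A : pzRingType) (r : nat) (B : zplus_ring A r) (x : A)
    : 'M[int]_r :=
  \matrix_(j, k) zcoord B (x * zbasis B j) k.

(* The positivity condition determines the ring homomorphism uniquely. *)
Definition is_FPdim (R : realType) (A : pzRingType) (r : nat)
    (B : zplus_ring A r) (f : {rmorphism A -> R}) : Prop :=
  forall i : 'I_r, 0 < f (zbasis B i).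

Definition integral_FPdim (R : realType) (A : pzRingType)
    (f : {rmorphism A -> R}) : Prop :=
  forall x : A, f x \is a Num.int.

(* The canonically normalized row vector p of an integral Z_+-ring. *)
Definition is_FPvector (R : realType) (A : pzRingType) (r : nat)
    (B : zplus_ring A r) (f : {rmorphism A -> R}) (p : 'I_r -> nat) : Prop :=
  [/\ forall i : 'I_r, (0 < p i)%N,
      \big[gcdn/0%N]_(i < r) p i = 1%N &
      forall i : 'I_r,
        (\row_j (p j)%:R) *m map_mx intr (zmulmx B (zbasis B i))
        = f (zbasis B i) *: (\row_j (p j)%:R) ].

Definition FPdim_ring (R : realType) (A : pzRingType) (r : nat)
    (B : zplus_ring A r) (f : {rmorphism A -> R}) (p : 'I_r -> nat) : R :=
  \sum_(i < r) (p i)%:R * f (zbasis B i).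

Definition zplus_generator (A : pzRingType) (r : nat) (B : zplus_ring A r)
    (x : A) : Prop :=
  exists n : nat, forall i : 'I_r, 0 < zcoord B (\sum_(k < n.+1) x ^+ k) i.

(* The division is exact when d is a root of the characteristic polynomial,
   as is the case for d = FPdim x. *)
Definition reduced_char_poly (R : realType) (A : pzRingType) (r : nat)
    (B : zplus_ring A r) (x : A) (d : R) : {poly R} :=
  map_poly intr (char_poly (zmulmx B x)) %/ ('X - d%:P).

(* The complex roots of a nonzero polynomial, repeated with multiplicity. *)
Definition complex_roots (R : realType) (q : {poly R}) : seq R[i] :=
  sval (closed_field_poly_normal (map_poly (real_complex R) q)).

Definition num_upper_roots (R : realType) (q : {poly R}) : nat :=
  count (fun z : R[i] => 0 < complex.Im z) (complex_roots q).

(* Main.v *)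
Require Import Defs.
From HB Require Import structures.
From mathcomp Require Import all_boot all_order all_algebra.
From mathcomp Require Import complex polyrcf ring lra zify.
From mathcomp Require Import reals exp.

Set Implicit Arguments.
Unset Strict Implicit.
Unset Printing Implicit Defensive.

Import Order.TTheory GRing.Theory Num.Theory.

Local Open Scope ring_scope.

(** Write M for the real matrix of multiplication by b, w for the column of the
    FPdim (b_i), p for the canonical row, and chi = (z - d) Q for the
    characteristic polynomial of M, so that M w = d w and p M = d p.

    Part (i).  Some sum 1 + b + ... + b^n acts by a matrix with positive entries,
    and an eigenvector of such a matrix for the eigenvalue of a positive
    eigenvector is proportional to it ([positive_mx_eigenline]); so w and p span
    the two eigenspaces of M at d.  As d - M is singular, its adjugate has
    columns in the first eigenspace and rows in the second, hence equals
    c w p for a scalar c, and c is nonzero because a principal minor of d - M is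
    ([adj_rank1]).  On the other hand adj(z - M) w = Q(z) w as polynomials, since
    both sides agree after multiplication by z - d ([adj_eigenvector]).  At z = d
    this says Q(d) = c (p w) = c N.  The row of the adjugate at the unit is the
    integer vector c p, and the p_i have no common factor, so c is an integer.
    Finally Q(d) > 0, because Q is monic, does not vanish at d, and has no real
    root beyond d: every eigenvalue has modulus at most d
    ([eigenvalue_norm_le]).

    Part (ii).  Let z run over the r - 1 roots of Q.  From |z| <= d one gets
    |d - z|^2 <= 2 d (d - Re z), so each of the s pairs of conjugate nonreal
    roots contributes at most d * 2 (d - Re z) to Q(d).  This bounds Q(d) by d^s
    times a product of c = r - 1 - s nonnegative factors, one for each real root
    or conjugate pair, whose sum is (r - 1) d - sum z = r d - tr M <= r d, since
    M has nonnegative entries.  The inequality between arithmetic and geometric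
    means gives Q(d) <= d^(r-1) (r / c)^c ([sqr_prod_dist_le],
    [reduced_char_poly_le]), and N <= Q(d).

    Part (iii).  As 2 s <= r - 1, c is at least the upper half of r - 1, and on
    that range (c / r)^c increases with c ([ratio_exp_le]); at the upper half it
    is at least (1/2)^(r-1) ([half_exp_le]). *)

(** * Adjugates and positive eigenvectors *)

(** The maximum principle: for the largest ratio t of the coordinates of v and w,
    the vector t w - v is nonnegative, vanishes somewhere, and is an eigenvector
    of P; a row of P at a zero coordinate then forces it to vanish everywhere. *)
Lemma positive_mx_eigenline (F : realFieldType) (n : nat) (P : 'M[F]_n)
    (a : F) (w v : 'cV[F]_n) :
  (forall i j, 0 < P i j) -> (forall i, 0 < w i 0) ->
  P *m w = a *: w -> P *m v = a *: v -> exists t, v = t *: w.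
Proof.
move=> P_gt0 w_gt0 Pw Pv; case: n => [|n] in P w v P_gt0 w_gt0 Pw Pv *.
  by exists 0; rewrite [v]flatmx0 [RHS]flatmx0.
have [k _ kmax] := @arg_maxP _ _ _ ord0 predT (fun i => v i 0 / w i 0) isT.
set t := v k 0 / w k 0 in kmax; exists t.
pose u := t *: w - v.
have u_ge0 j : 0 <= u j 0.
  by rewrite !mxE subr_ge0 -ler_pdivrMr ?w_gt0 //; apply: kmax.
have uk : u k 0 = 0 by rewrite !mxE divfK ?subrr ?gt_eqF.
have Pu : P *m u = a *: u.
  by rewrite mulmxBr -scalemxAr Pw Pv scalerBr !scalerA mulrC.
have /eqP : \sum_j P k j * u j 0 = 0.
  by have /matrixP/(_ k 0) := Pu; rewrite !mxE => ->; rewrite -[RHS](mulr0 a) -uk !mxE.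
rewrite psumr_eq0; last by move=> j _; rewrite mulr_ge0 ?u_ge0 // ltW.
move=> /allP u0; apply/esym/eqP; rewrite -subr_eq0 -/u; apply/eqP/matrixP=> j l.
rewrite [RHS]mxE (ord1 l); apply/eqP.
by have := u0 j (mem_index_enum j); rewrite mulf_eq0 gt_eqF.
Qed.

(** A vector killed by the principal submatrix extends by 0 to a vector in the
    left kernel of T, that is, to a multiple of p, whose i-th coordinate is
    nonzero unless the multiple is 0. *)
Lemma cofactor_diag_neq0 (F : fieldType) (n : nat) (T : 'M[F]_n)
    (w : 'cV[F]_n) (p : 'rV[F]_n) (i : 'I_n) :
  w i 0 != 0 -> p 0 i != 0 -> T *m w = 0 ->
  (forall v : 'rV_n, v *m T = 0 -> exists t, v = t *: p) ->
  cofactor T i i != 0.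
Proof.
move=> wi pi Tw kerT; rewrite /cofactor mulf_neq0 ?signr_eq0 //.
apply/negP=> /det0P[v' v'_neq0 v'T].
(* Extending v' by 0 at i, only the i-th coordinate of v *m T can survive,
   and pairing with w kills it. *)
pose v : 'rV_n := \row_j oapp (v' 0) 0 (unlift i j).
have vi : v 0 i = 0 by rewrite mxE unlift_none.
have vl j : v 0 (lift i j) = v' 0 j by rewrite mxE liftK.
have vTl j : (v *m T) 0 (lift i j) = 0.
  rewrite mxE (bigD1_ord i) //= vi mul0r add0r.
  have /matrixP/(_ 0 j) := v'T; rewrite !mxE => v'Tj; rewrite -[RHS]v'Tj.
  by apply: eq_bigr => k _; rewrite vl !mxE.
have vTi : (v *m T) 0 i = 0.
  have /matrixP/(_ 0 0) : v *m T *m w = 0 by rewrite -mulmxA Tw mulmx0.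
  rewrite mxE (bigD1_ord i) //= big1 => [|j _]; last by rewrite vTl mul0r.
  by rewrite addr0 [RHS]mxE => /eqP; rewrite mulf_eq0 (negbTE wi) orbF => /eqP.
have [t vE] : exists t, v = t *: p.
  apply: kerT; apply/rowP=> j; rewrite [RHS]mxE.
  by case: (unliftP i j) => [k|] ->.
have t0 : t = 0.
  by move: vi; rewrite vE mxE => /eqP; rewrite mulf_eq0 (negbTE pi) orbF => /eqP.
case/eqP: v'_neq0; apply/rowP=> j.
by rewrite -vl vE t0 scale0r !mxE.
Qed.

(** Since T has determinant 0, T adj(T) = 0 = adj(T) T, so the columns of adj(T)
    are multiples of w and its rows multiples of p. *)
Lemma adj_rank1 (F : fieldType) (n : nat) (T : 'M[F]_n)
    (w : 'cV[F]_n) (p : 'rV[F]_n) (i : 'I_n) :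
  w i 0 != 0 -> p 0 i != 0 -> T *m w = 0 -> p *m T = 0 ->
  (forall v : 'cV_n, T *m v = 0 -> exists t, v = t *: w) ->
  (forall v : 'rV_n, v *m T = 0 -> exists t, v = t *: p) ->
  exists2 c, c != 0 & \adj T = c *: (w *m p).
Proof.
move=> wi pi Tw pT kerTr kerTl.
have detT : \det T = 0.
  apply/eqP/det0P; exists p => //.
  by apply: contraNneq pi => ->; rewrite mxE.
(* The coefficients of the columns on w are read off at the coordinate i. *)
have [u adjE] : exists u : 'rV_n, \adj T = w *m u.
  exists (\row_j (\adj T i j / w i 0)); apply/matrixP=> k j.
  have [] := kerTr (col j (\adj T)).
    by rewrite colE mulmxA mul_mx_adj detT [_%:M]raddf0 mul0mx.
  move=> t /matrixP E; have adjT l : \adj T l j = t * w l 0.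
    by have := E l 0; rewrite [LHS]mxE [RHS]mxE.
  by rewrite [RHS]mxE big_ord1 [X in _ * X]mxE !adjT mulfK // mulrC.
have [] := kerTl u.
  have : w *m (u *m T) = 0.
    by rewrite mulmxA -adjE mul_adj_mx detT [_%:M]raddf0.
  move=> /matrixP wuT; apply/rowP=> j; have := wuT i j.
  by rewrite mxE big_ord1 [RHS]mxE => /eqP; rewrite mulf_eq0 (negbTE wi) [RHS]mxE => /eqP.
move=> c uE; exists c; last by rewrite adjE uE scalemxAr.
have := cofactor_diag_neq0 wi pi Tw kerTl.
have /matrixP/(_ i i) := adjE; rewrite uE !mxE big_ord1 !mxE => ->.
by rewrite !mulf_eq0 !negb_or => /and3P[].
Qed.

(** Over polynomials, (X - M) w = (X - d) w; multiplying by adj(X - M) gives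
    (X - d) adj(X - M) w = chi w = (X - d) Q w, and X - d cancels.  This yields
    the value of chi / (X - d) at d without differentiating a determinant. *)
Lemma adj_eigenvector (F : fieldType) (n : nat) (M : 'M[F]_n)
    (d : F) (w : 'cV[F]_n) : w != 0 -> M *m w = d *: w ->
  \adj (d%:M - M) *m w = (char_poly M %/ ('X - d%:P)).[d] *: w
  /\ char_poly M = (char_poly M %/ ('X - d%:P)) * ('X - d%:P).
Proof.
move=> w_neq0 Mw; set Q := _ %/ _.
have rootM : root (char_poly M) d.
  have -> : char_poly M = char_poly M^T.
    rewrite /char_poly -det_tr; congr (\det _); rewrite /char_poly_mx.
    by rewrite linearB /= tr_scalar_mx map_trmx.
  rewrite -eigenvalue_root_char; apply/eigenvalueP; exists w^T.
    by rewrite -trmx_mul Mw linearZ.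
  by apply: contraNneq w_neq0 => /(congr1 trmx); rewrite trmxK trmx0 => ->.
have chiE : char_poly M = Q * ('X - d%:P) by rewrite divpK // dvdp_XsubCl.
split=> //.
pose W := map_mx polyC w.
have MW : char_poly_mx M *m W = ('X - d%:P) *: W.
  rewrite /char_poly_mx mulmxBl mul_scalar_mx -map_mxM Mw map_mxZ.
  by rewrite scalerBl.
have adjW : \adj (char_poly_mx M) *m W = Q *: W.
  have : ('X - d%:P) *: (\adj (char_poly_mx M) *m W) = ('X - d%:P) *: (Q *: W).
    rewrite scalemxAr -MW mulmxA mul_adj_mx mul_scalar_mx scalerA mulrC.
    by rewrite -chiE.
  move=> /matrixP E; apply/matrixP=> i j; have := E i j.
  by rewrite [LHS]mxE [RHS]mxE; apply: mulfI; rewrite polyXsubC_eq0.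
have /(congr1 (map_mx (horner_eval d))) := adjW.
rewrite map_mxM map_mx_adj map_mxZ /= !horner_evalE.
have -> : map_mx (horner_eval d) W = w.
  by apply/matrixP=> i j; rewrite !mxE horner_evalE hornerC.
suff -> : map_mx (horner_eval d) (char_poly_mx M) = d%:M - M by [].
apply/matrixP=> i j; rewrite !mxE horner_evalE hornerD hornerN hornerC.
by case: (i == j); rewrite !(mulr0n, mulr1n) ?hornerX ?horner0.
Qed.

(** * Bounding a real polynomial by the real parts of its roots *)

(** For a left eigenvector v, pairing |z| |v| <= |v| M with the positive right
    eigenvector w gives |z| (|v| w) <= d (|v| w), where |v| w > 0.  It is stated
    over a numFieldType so as to cover real and complex eigenvalues at once. *)
Lemma eigenvalue_norm_le (K : numFieldType) (n : nat) (M : 'M[K]_n)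
    (d : K) (w : 'cV[K]_n) (z : K) :
  (forall i j, 0 <= M i j) -> (forall i, 0 < w i 0) -> M *m w = d *: w ->
  root (char_poly M) z -> `|z| <= d.
Proof.
move=> M_ge0 w_gt0 Mw; rewrite -eigenvalue_root_char.
move=> /eigenvalueP[v vM v_neq0].
pose S := \sum_j `|v 0 j| * w j 0.
have S_gt0 : 0 < S.
  rewrite lt_def sumr_ge0 ?andbT => [|j _]; last by rewrite mulr_ge0 // ltW.
  apply: contra v_neq0; rewrite psumr_eq0 => [/allP v0|j _]; last first.
    by rewrite mulr_ge0 // ltW.
  apply/eqP/rowP=> j; apply/eqP; rewrite [X in _ == X]mxE.
  have := v0 j (mem_index_enum j).
  by rewrite /= mulf_eq0 (gt_eqF (w_gt0 j)) orbF normr_eq0.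
suff : `|z| * S <= d * S by rewrite ler_pM2r.
have vMk k : `|z| * `|v 0 k| <= \sum_j `|v 0 j| * M j k.
  have /matrixP/(_ 0 k) := vM; rewrite !mxE -normrM => <-.
  apply: le_trans (ler_norm_sum _ _ _) _.
  by apply: ler_sum => j _; rewrite normrM [`|M j k|]ger0_norm.
rewrite mulr_sumr.
apply: (@le_trans _ _ (\sum_k (\sum_j `|v 0 j| * M j k) * w k 0)).
  by apply: ler_sum => k _; rewrite mulrA ler_pM2r.
under eq_bigr do rewrite mulr_suml.
rewrite exchange_big /= mulr_sumr le_eqVlt; apply/orP; left; apply/eqP.
apply: eq_bigr => j _; have /matrixP/(_ j 0) := Mw; rewrite !mxE => Mwj.
by rewrite mulrCA -Mwj mulr_sumr; apply: eq_bigr => k _; rewrite mulrA.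
Qed.

Lemma prod_le_mean_exp (K : numFieldType) (L : seq K) :
  {in L, forall x, 0 <= x} ->
  \prod_(x <- L) x <= ((\sum_(x <- L) x) / (size L)%:R) ^+ size L.
Proof.
move=> L_ge0; rewrite (big_tnth _ _ L) [X in X / _](big_tnth _ _ L).
have [|+ _] := @leif_AGM _ _ 'I_(size L) (tnth (in_tuple L)).
  by move=> i _; apply/L_ge0/mem_tnth.
by rewrite cardT size_enum_ord; under eq_bigl do rewrite inE;
   under [in X in _ <= X -> _]eq_bigl do rewrite inE.
Qed.

Lemma complex_roots_prod (R : realType) (q : {poly R}) : q \is monic ->
  map_poly (real_complex R) q = \prod_(z <- complex_roots q) ('X - z%:P).
Proof.
move=> q_monic; rewrite /complex_roots.
case: closed_field_poly_normal => rs /= {1}->.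
by rewrite lead_coef_map (monicP q_monic) rmorph1 scale1r.
Qed.

Lemma complex_roots_conj (R : realType) (q : {poly R}) : q \is monic ->
  perm_eq (complex_roots q) (map (@conjc R) (complex_roots q)).
Proof.
move=> q_monic; apply: prod_XsubC_eq; rewrite -complex_roots_prod // big_map.
have -> : map_poly (real_complex R) q =
    map_poly (@conjc R) (map_poly (real_complex R) q).
  by rewrite -map_poly_comp; apply: eq_map_poly => x /=; rewrite oppr0.
rewrite complex_roots_prod // rmorph_prod; apply: eq_bigr => z _.
by rewrite rmorphB /= map_polyX map_polyC.
Qed.

Lemma count_Im_neq0 (R : rcfType) (rs : seq R[i]) :
  perm_eq rs (map (@conjc R) rs) ->
  count (fun z : R[i] => complex.Im z != 0) rs =
  (count (fun z : R[i] => 0 < complex.Im z) rs).*2.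
Proof.
move=> conj_rs; rewrite -addnn.
have {2}-> : count (fun z : R[i] => 0 < complex.Im z) rs =
             count (fun z : R[i] => complex.Im z < 0) rs.
  rewrite [LHS](permP conj_rs) count_map; apply: eq_count => -[x y] /=.
  by rewrite oppr_gt0.
rewrite -count_predUI [X in (_ + X)%N](_ : _ = 0%N).
  by rewrite addn0; apply: eq_count => z /=; rewrite neq_lt orbC.
rewrite (@eq_count _ _ pred0) ?count_pred0 // => z /=.
by apply/negP=> /andP[h1 h2]; have := lt_trans h1 h2; rewrite ltxx.
Qed.

(** Squaring lets real and nonreal roots be treated one at a time: a real root
    contributes (d - z)^2, which is kept as two factors d - z, while a nonreal
    one contributes at most d * 2 (d - Re z), by |z| <= d.  The resulting list of
    2 c nonnegative factors has sum twice that of the d - Re z, and the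
    inequality of means applies to it. *)
Lemma sqr_prod_dist_le (R : rcfType) (rs : seq R[i]) (d T : R) (s c : nat) :
  perm_eq rs (map (@conjc R) rs) ->
  0 <= d -> {in rs, forall z, `|z| <= d%:C%C} ->
  \sum_(z <- rs) (d - complex.Re z) <= T ->
  count (fun z : R[i] => 0 < complex.Im z) rs = s -> (s + c = size rs)%N ->
  \prod_(z <- rs) ((d - complex.Re z) ^+ 2 + complex.Im z ^+ 2)
    <= d ^+ s.*2 * (T / c%:R) ^+ c.*2.
Proof.
move=> conj_rs d_ge0 rs_le sumT sE cE.
have disk z : z \in rs ->
    0 <= d - complex.Re z /\ complex.Re z ^+ 2 + complex.Im z ^+ 2 <= d ^+ 2.
  move=> /rs_le; rewrite normc_def lecR => zd.
  have zd2 : complex.Re z ^+ 2 + complex.Im z ^+ 2 <= d ^+ 2.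
    by rewrite -ler_sqrt ?sqr_ge0 // [in X in _ <= X]sqrtr_sqr ger0_norm.
  split=> //; rewrite subr_ge0 leNgt; apply/negP=> dz.
  have xd : 0 < complex.Re z - d by rewrite subr_gt0.
  have := sqr_ge0 (complex.Im z); have := mulr_ge0 d_ge0 (ltW xd).
  by have := mulr_gt0 xd xd; nra.
pose t (z : R[i]) : R := d - complex.Re z.
(* The list of factors contributed by the root z, apart from powers of d. *)
pose g z := if complex.Im z == 0 then [:: t z; t z] else [:: 2 * t z].
pose L := flatten (map g rs).
have L_ge0 : {in L, forall x, 0 <= x}.
  move=> x /flatten_mapP[z /disk[t_ge0 _]].
  rewrite /g; case: ifP => _; rewrite !inE ?orbb => /eqP-> //.
  by rewrite mulr_ge0.
have sumL : \sum_(x <- L) x = 2 * \sum_(z <- rs) t z.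
  rewrite big_flatten /= big_map mulr_sumr; apply: eq_bigr => z _.
  rewrite /g; case: ifP => _; rewrite !big_cons big_nil addr0 //.
  by rewrite mulr_natl mulr2n.
have sizeL : size L = c.*2.
  have -> : size L = (size rs + count (fun z : R[i] => complex.Im z == 0%R) rs)%N.
    rewrite /L; elim: (rs) => //= z l IH; rewrite size_cat IH.
    by rewrite /g; case: ifP => _ /=; lia.
  have := count_predC (fun z : R[i] => complex.Im z == 0) rs.
  rewrite [X in (_ + X)%N = _](_ : _ = s.*2); last first.
    by rewrite -sE -(count_Im_neq0 conj_rs); apply: eq_count.
  lia.
have prodL l : {subset l <= rs} ->
    \prod_(z <- l) ((d - complex.Re z) ^+ 2 + complex.Im z ^+ 2)
    <= d ^+ count (fun z : R[i] => complex.Im z != 0) l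
       * \prod_(x <- flatten (map g l)) x.
  elim: l => [|z l IH] sub; first by rewrite !big_nil mul1r.
  have z_rs : z \in rs by apply: sub; rewrite mem_head.
  have {}IH := IH (fun y yl => sub y (mem_behead (s := z :: l) yl)).
  have [t_ge0 dz] := disk z z_rs.
  rewrite big_cons /= big_cat /= {1}/g.
  have P_ge0 : 0 <= \prod_(y <- l) ((d - complex.Re y) ^+ 2 + complex.Im y ^+ 2).
    by apply: prodr_ge0 => y _; rewrite addr_ge0 ?sqr_ge0.
  case: (eqVneq (complex.Im z) 0) => [Imz|Imz] /=.
    rewrite add0n !big_cons big_nil mulr1 Imz expr0n addr0 mulrCA.
    by rewrite -expr2 ler_wpM2l ?sqr_ge0.
  rewrite add1n [d ^+ _.+1]exprS big_cons big_nil mulr1 mulrACA.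
  apply: ler_pM => //; first by rewrite addr_ge0 ?sqr_ge0.
  by rewrite /t; nra.
rewrite -sE -(count_Im_neq0 conj_rs).
apply: le_trans (prodL rs _) _ => //; rewrite ler_wpM2l ?exprn_ge0 //.
apply: le_trans (prod_le_mean_exp L_ge0) _; rewrite sumL sizeL.
have t_ge0 : 0 <= \sum_(z <- rs) t z.
  by rewrite big_seq sumr_ge0 // => z /disk[].
have -> : c.*2%:R = 2 * c%:R :> R by rewrite -mul2n natrM.
rewrite invfM mulrACA divff ?pnatr_eq0 // mul1r.
rewrite lerXn2r ?nnegrE ?divr_ge0 ?ler0n //; first exact: le_trans sumT.
by rewrite ler_wpM2r ?invr_ge0 ?ler0n.
Qed.

(** * The regular representation of a Z+-ring *)

Section RegularRepresentation.

Context (A : pzRingType) (r : nat) (B : zplus_ring A r).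

Lemma zcoord_comb (I : finType) (y : I -> A) (c : I -> int) (k : 'I_r) :
  zcoord B (\sum_i y i *~ c i) k = \sum_i c i * zcoord B (y i) k.
Proof.
rewrite -(zcoordK B (fun k => \sum_i c i * zcoord B (y i) k)); congr zcoord.
under [RHS]eq_bigr do rewrite mulrz_sumr.
rewrite exchange_big /=; apply: eq_bigr => i _.
rewrite [in LHS](zcoord_sum B (y i)) mulrz_suml; apply: eq_bigr => j _.
by rewrite mulrC mulrzA.
Qed.

Lemma zmulmx_comb (I : finType) (y : I -> A) (c : I -> int) :
  zmulmx B (\sum_i y i *~ c i) = \sum_i c i *: zmulmx B (y i).
Proof.
apply/matrixP=> j k; rewrite mxE mulr_suml summxE.
under eq_bigr do rewrite mulrzAl.
by rewrite zcoord_comb; apply: eq_bigr => i _; rewrite !mxE.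
Qed.

Lemma zmulmxE (x : A) :
  zmulmx B x = \sum_i zcoord B x i *: zmulmx B (zbasis B i).
Proof. by rewrite {1}[x](zcoord_sum B) zmulmx_comb. Qed.

(** The order is reversed because the coordinates of x * b_j are stored in rows,
    so matrices act on row vectors of coordinates. *)
Lemma zmulmxM (x y : A) : zmulmx B (x * y) = zmulmx B y *m zmulmx B x.
Proof.
apply/matrixP=> j l; rewrite !mxE -mulrA.
rewrite [y * _](zcoord_sum B) mulr_sumr.
under eq_bigr do rewrite mulrzAr.
by rewrite zcoord_comb; apply: eq_bigr => k _; rewrite !mxE.
Qed.

Lemma zcoord_basis (j k : 'I_r) : zcoord B (zbasis B j) k = (j == k)%:R.
Proof.
rewrite -(zcoordK B (fun k => (j == k)%:R)); congr zcoord.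
rewrite (bigD1 j) //= eqxx big1 ?addr0 // => i.
by rewrite eq_sym => /negbTE->.
Qed.

Lemma zmulmx1 : zmulmx B 1 = 1%:M.
Proof. by apply/matrixP=> j k; rewrite !mxE mul1r zcoord_basis. Qed.

Lemma zmulmx_ge0 (x : A) : (forall i, 0 <= zcoord B x i) ->
  forall j k, 0 <= zmulmx B x j k.
Proof.
move=> x_ge0 j k; rewrite zmulmxE summxE sumr_ge0 // => i _.
by rewrite !mxE mulr_ge0 ?zstruct_ge0.
Qed.

(** This is where transitivity enters: for given j and k some N_ij^k is positive. *)
Lemma zmulmx_gt0 (x : A) : (forall i, 0 < zcoord B x i) ->
  forall j k, 0 < zmulmx B x j k.
Proof.
move=> x_gt0 j k; rewrite zmulmxE summxE.
have [i Ni] := ztransitive B j k.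
rewrite (bigD1 i) //=; apply: ltr_wpDr; last by rewrite !mxE mulr_gt0.
by rewrite sumr_ge0 // => l _; rewrite !mxE mulr_ge0 ?zstruct_ge0 // ltW.
Qed.

End RegularRepresentation.

Section PowerSums.

Context (R : realType) (A : pzRingType) (r : nat) (B : zplus_ring A r).

Local Notation realmx x := (map_mx intr (zmulmx B x) : 'M[R]_r).

(** Eigenvectors of x become eigenvectors of 1 + x + ... + x^(n-1), whose
    matrix is positive when x is a generator and n is large. *)
Lemma geometric_mx_eigencol (x : A) (a : R) (v : 'cV[R]_r) (n : nat) :
  realmx x *m v = a *: v ->
  realmx (\sum_(k < n) x ^+ k) *m v = (\sum_(k < n) a ^+ k) *: v.
Proof.
move=> xv.
have xkv k : realmx (x ^+ k) *m v = a ^+ k *: v.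
  elim: k => [|k IH]; first by rewrite zmulmx1 map_mx1 mul1mx scale1r.
  by rewrite exprS zmulmxM map_mxM -mulmxA xv -scalemxAr IH scalerA exprS.
under eq_bigr do rewrite -[_ ^+ _]mulr1z.
rewrite zmulmx_comb raddf_sum /= mulmx_suml scaler_suml.
by apply: eq_bigr => k _; rewrite scale1r xkv.
Qed.

Lemma geometric_mx_eigenrow (x : A) (a : R) (v : 'rV[R]_r) (n : nat) :
  v *m realmx x = a *: v ->
  v *m realmx (\sum_(k < n) x ^+ k) = (\sum_(k < n) a ^+ k) *: v.
Proof.
move=> vx.
have vxk k : v *m realmx (x ^+ k) = a ^+ k *: v.
  elim: k => [|k IH]; first by rewrite zmulmx1 map_mx1 mulmx1 scale1r.
  by rewrite exprSr zmulmxM map_mxM mulmxA vx -scalemxAl IH scalerA exprS.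
under eq_bigr do rewrite -[_ ^+ _]mulr1z.
rewrite zmulmx_comb raddf_sum /= mulmx_sumr scaler_suml.
by apply: eq_bigr => k _; rewrite scale1r vxk.
Qed.

End PowerSums.

(** * The reduced characteristic polynomial at the Frobenius-Perron dimension *)

Section FrobeniusPerron.

Context (R : realType) (A : pzRingType) (r : nat) (B : zplus_ring A r).
Context (f : {rmorphism A -> R}) (p : 'I_r -> nat) (x : A).
Hypothesis f_FP : is_FPdim B f.
Hypothesis p_FP : is_FPvector B f p.
Hypothesis x_ge0 : forall i, 0 <= zcoord B x i.
Hypothesis x_gen : zplus_generator B x.

Local Notation realmx y := (map_mx intr (zmulmx B y) : 'M[R]_r).
Local Notation w := (\col_j f (zbasis B j)).
Local Notation pr := (\row_j ((p j)%:R : R)).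
Local Notation M := (realmx x).
Local Notation d := (f x).
Local Notation N := (FPdim_ring B f p).
Local Notation Q := (reduced_char_poly B x d).

Let w_gt0 i : 0 < w i 0. Proof. by rewrite mxE. Qed.

Let pr_gt0 i : 0 < pr 0 i.
Proof. by rewrite mxE ltr0n; case: p_FP. Qed.

Lemma FPdim_comb (y : A) : f y = \sum_i (zcoord B y i)%:~R * f (zbasis B i).
Proof.
rewrite {1}[y](zcoord_sum B) rmorph_sum; apply: eq_bigr => i _.
by rewrite rmorphMz /= mulrzl.
Qed.

Lemma FPdim_ge0 : 0 <= d.
Proof.
by rewrite FPdim_comb sumr_ge0 // => i _; rewrite mulr_ge0 ?ler0z // ltW.
Qed.

(** This is the multiplicativity of f read in coordinates. *)
Lemma FPdim_eigencol (y : A) : realmx y *m w = f y *: w.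
Proof.
apply/colP=> j; rewrite !mxE -rmorphM /= [in RHS]FPdim_comb.
by apply: eq_bigr => k _; rewrite !mxE.
Qed.

Lemma FPvector_eigenrow (y : A) : pr *m realmx y = f y *: pr.
Proof.
rewrite zmulmxE raddf_sum /= mulmx_sumr FPdim_comb scaler_suml.
apply: eq_bigr => i _; case: p_FP => _ _ pN.
by rewrite map_mxZ -scalemxAr pN scalerA.
Qed.

Lemma FPdim_eigencol_unique (v : 'cV_r) :
  M *m v = d *: v -> exists t, v = t *: w.
Proof.
move=> Mv; have [n /zmulmx_gt0 P_gt0] := x_gen.
apply: positive_mx_eigenline (geometric_mx_eigencol n.+1 (FPdim_eigencol x))
  (geometric_mx_eigencol n.+1 Mv) => // i j.
by rewrite mxE ltr0z.
Qed.

Lemma FPvector_eigenrow_unique (v : 'rV_r) :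
  v *m M = d *: v -> exists t, v = t *: pr.
Proof.
move=> vM; have [n /zmulmx_gt0 P_gt0] := x_gen.
have prP := geometric_mx_eigenrow n.+1 (FPvector_eigenrow x).
have vP := geometric_mx_eigenrow n.+1 vM.
have [] := @positive_mx_eigenline _ _ (realmx (\sum_(k < n.+1) x ^+ k))^T
  (\sum_(k < n.+1) d ^+ k) pr^T v^T.
- by move=> i j; have := P_gt0 j i; rewrite -(ltr0z R) !mxE.
- by move=> i; rewrite mxE pr_gt0.
- by rewrite -trmx_mul prP linearZ.
- by rewrite -trmx_mul vP linearZ.
by move=> t /(congr1 trmx); rewrite linearZ /= !trmxK => ->; exists t.
Qed.

Lemma adj_FP : exists2 c, c != 0 & \adj (d%:M - M) = c *: (w *m pr).
Proof.
apply: (adj_rank1 (i := zone B)); rewrite ?gt_eqF //.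
- by rewrite mulmxBl FPdim_eigencol mul_scalar_mx subrr.
- by rewrite mulmxBr FPvector_eigenrow mul_mx_scalar subrr.
- move=> v /eqP; rewrite mulmxBl mul_scalar_mx subr_eq0 => /eqP Mv.
  exact: FPdim_eigencol_unique.
- move=> v /eqP; rewrite mulmxBr mul_mx_scalar subr_eq0 => /eqP vM.
  exact: FPvector_eigenrow_unique.
Qed.

Lemma FPdim_ringE : pr *m w = N%:M.
Proof.
apply/matrixP=> i j; rewrite !ord1 !mxE mulr1n.
by apply: eq_bigr => k _; rewrite !mxE.
Qed.

Lemma FPdim_ring_gt0 : 0 < N.
Proof.
rewrite /FPdim_ring (bigD1 (zone B)) //=; apply: ltr_wpDr.
  by rewrite sumr_ge0 // => i _; rewrite mulr_ge0 // ltW.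
by rewrite mulr_gt0 // ltr0n; case: p_FP.
Qed.

Lemma char_poly_realmx : map_poly intr (char_poly (zmulmx B x)) = char_poly M.
Proof. exact: map_char_poly. Qed.

Let w_neq0 : w != 0.
Proof.
by apply/eqP=> /matrixP/(_ (zone B) 0)/eqP; rewrite [X in _ == X]mxE gt_eqF.
Qed.

Lemma char_poly_factor : char_poly M = Q * ('X - d%:P).
Proof.
rewrite /reduced_char_poly char_poly_realmx.
by have [] := adj_eigenvector w_neq0 (FPdim_eigencol x).
Qed.

Lemma reduced_char_poly_monic : Q \is monic.
Proof.
by rewrite -(monicMr _ (monicXsubC d)) -char_poly_factor char_poly_monic.
Qed.

Lemma horner_reduced_char_poly (c : R) :
  \adj (d%:M - M) = c *: (w *m pr) -> Q.[d] = c * N.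
Proof.
have [+ _] := adj_eigenvector w_neq0 (FPdim_eigencol x).
rewrite -char_poly_realmx -/Q => + adjE.
rewrite adjE -scalemxAl -mulmxA FPdim_ringE mul_mx_scalar scalerA.
move=> /matrixP/(_ (zone B) 0); rewrite !mxE zone1 rmorph1 !mulr1.
by move->.
Qed.

(** If Q(d) were negative, Q, being monic, would have a real root beyond d, which
    the bound on eigenvalues forces to be d itself; but Q(d) = c N is nonzero. *)
Lemma reduced_char_poly_gt0 : 0 < Q.[d].
Proof.
have [c c_neq0 /horner_reduced_char_poly QdE] := adj_FP.
have Qd_neq0 : Q.[d] != 0 by rewrite QdE mulf_neq0 // gt_eqF ?FPdim_ring_gt0.
rewrite lt_def Qd_neq0 leNgt; apply/negP=> Qd_lt0.
have lcQ := monicP reduced_char_poly_monic.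
have [|a Qa] := @poly_pinfty_gt_lc _ Q; first by rewrite lcQ ltr01.
have [||y /andP[dy _] Qy] := @poly_ivt _ Q d (Num.max d a).
- by rewrite le_max lexx.
- rewrite (ltW Qd_lt0) /= (le_trans _ (Qa _ _)) ?lcQ ?ler01 //.
  by rewrite le_max lexx orbT.
have : `|y| <= d.
  apply: eigenvalue_norm_le w_gt0 (FPdim_eigencol x) _.
    by move=> i j; rewrite mxE ler0z zmulmx_ge0.
  by rewrite char_poly_factor rootM Qy.
move=> /(le_trans (ler_norm y)) yd.
have ydE : y = d by apply/le_anti; rewrite yd dy.
by move: Qy; rewrite ydE /root (negbTE Qd_neq0).
Qed.

Lemma size_reduced_char_poly_roots : size (complex_roots Q) = r.-1.
Proof.
have Qmon := reduced_char_poly_monic.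
have := congr1 (fun q : {poly R} => size q) char_poly_factor.
rewrite size_char_poly size_Mmonic ?monic_neq0 ?monicXsubC // size_XsubC addn2 /=.
move=> [rE]; apply/esym; rewrite [in LHS]rE -(size_map_poly (real_complex R)).
by rewrite complex_roots_prod // size_prod_XsubC.
Qed.

Let realmxC : 'M[R[i]]_r := map_mx (real_complex R) M.

Lemma char_poly_complex_roots :
  char_poly realmxC = \prod_(z <- d%:C%C :: complex_roots Q) ('X - z%:P).
Proof.
rewrite -map_char_poly char_poly_factor rmorphM /= complex_roots_prod; last first.
  exact: reduced_char_poly_monic.
by rewrite big_cons mulrC rmorphB /= map_polyX map_polyC.
Qed.

Lemma complex_roots_norm_le : {in complex_roots Q, forall z, `|z| <= d%:C%C}.
Proof.
move=> z zQ.
apply: (@eigenvalue_norm_le _ _ realmxC _ (map_mx (real_complex R) w)).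
- by move=> i j; rewrite 2!mxE ler0c ler0z; apply: zmulmx_ge0.
- by move=> i; rewrite !mxE ltcR.
- by rewrite -map_mxM FPdim_eigencol map_mxZ.
by rewrite char_poly_complex_roots root_prod_XsubC inE zQ orbT.
Qed.

(** The roots of Q together with d sum to the trace of a nonnegative matrix. *)
Lemma sum_complex_roots_gap :
  \sum_(z <- complex_roots Q) (d - complex.Re z) <= r%:R * d.
Proof.
have r_gt0 : (0 < r)%N := leq_ltn_trans (leq0n _) (ltn_ord (zone B)).
have trE : \tr realmxC = d%:C%C + \sum_(z <- complex_roots Q) z.
  have := char_poly_trace realmxC r_gt0.
  have -> : r.-1 = (size (d%:C%C :: complex_roots Q)).-1.
    by rewrite /= size_reduced_char_poly_roots.
  by rewrite char_poly_complex_roots coefPn_prod_XsubC // big_cons => /oppr_inj.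
have tr_ge0 : 0 <= d + \sum_(z <- complex_roots Q) complex.Re z.
  have -> : d + \sum_(z <- complex_roots Q) complex.Re z = \tr M.
    have ReD : {morph @complex.Re R : y z / y + z} by move=> [? ?] [? ?].
    transitivity (complex.Re (\tr realmxC)); last by rewrite trace_map_mx.
    by rewrite trE ReD (big_morph _ ReD (erefl _)).
  by rewrite sumr_ge0 // => i _; rewrite mxE ler0z zmulmx_ge0.
rewrite sumrB big_const_seq count_predT iter_addr_0.
rewrite size_reduced_char_poly_roots -mulr_natl.
have -> : r%:R = r.-1%:R + 1 :> R by rewrite -[in LHS](prednK r_gt0) -natr1.
by rewrite mulrDl mul1r; lra.
Qed.

(** The squared modulus is handled as the multiplicative map
    z |-> (Re z)^2 + (Im z)^2 with real values, which avoids square roots. *)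
Lemma sqr_reduced_char_poly :
  Q.[d] ^+ 2 = \prod_(z <- complex_roots Q)
                 ((d - complex.Re z) ^+ 2 + complex.Im z ^+ 2).
Proof.
have QdC : (Q.[d])%:C%C = \prod_(z <- complex_roots Q) (d%:C%C - z).
  rewrite -horner_map /= complex_roots_prod ?reduced_char_poly_monic //.
  by rewrite horner_prod; apply: eq_bigr => z _; rewrite hornerXsubC.
pose nsq (z : R[i]) := complex.Re z ^+ 2 + complex.Im z ^+ 2.
have nsqM : {morph nsq : y z / y * z} by move=> [a b] [a' b'] /=; rewrite /nsq /=; ring.
have nsq1 : nsq 1 = 1 by rewrite /nsq /=; ring.
have -> : Q.[d] ^+ 2 = nsq (Q.[d])%:C%C by rewrite /nsq /=; ring.
rewrite QdC (big_morph nsq nsqM nsq1); apply: eq_bigr => -[a b] _.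
by rewrite /nsq /=; ring.
Qed.

Lemma double_upper_roots_le : ((num_upper_roots Q).*2 <= r.-1)%N.
Proof.
rewrite -size_reduced_char_poly_roots -count_Im_neq0; first exact: count_size.
exact/complex_roots_conj/reduced_char_poly_monic.
Qed.

(** Combines the bound on the product of the (d - z) with the bound r d on their
    sum, in the form Q(d) <= d^s (r d / c)^c. *)
Lemma reduced_char_poly_le (s c : nat) :
  num_upper_roots Q = s -> (s + c = r.-1)%N -> (0 < c)%N ->
  Q.[d] * (c%:R / r%:R) ^+ c <= d ^+ r.-1.
Proof.
move=> sE sc c_gt0.
have r_gt0 : (0 < r)%N := leq_ltn_trans (leq0n _) (ltn_ord (zone B)).
have := sqr_prod_dist_le (complex_roots_conj reduced_char_poly_monic) FPdim_ge0
  complex_roots_norm_le sum_complex_roots_gap sE.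
rewrite size_reduced_char_poly_roots => /(_ _ sc).
rewrite -sqr_reduced_char_poly -!muln2 !exprM -exprMn ler_sqr; last 2 first.
- by rewrite nnegrE ltW ?reduced_char_poly_gt0.
- by rewrite nnegrE mulr_ge0 ?exprn_ge0 ?divr_ge0 ?mulr_ge0 ?FPdim_ge0.
move=> Qd_le; apply: (@le_trans _ _ (d ^+ s * (r%:R * d / c%:R) ^+ c
                                     * (c%:R / r%:R) ^+ c)).
  by rewrite ler_wpM2r // exprn_ge0 // divr_ge0.
rewrite -mulrA -exprMn (_ : _ * (_ / _) = d) -?exprD ?sc //.
by field; rewrite !pnatr_eq0 -!lt0n c_gt0 r_gt0.
Qed.

(** The row of adj(d - M) at the unit equals c p, because w has coordinate
    f(1) = 1 there.  It is an integer vector, so c is rational with c p integral,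
    and hence an integer since the p_i have greatest common divisor 1. *)
Lemma FPdim_ring_dvd_reduced_char_poly : integral_FPdim f ->
  exists n q : nat, [/\ N = n%:R, Q.[d] = q%:R, (0 < q)%N & (n %| q)%N].
Proof.
move=> f_int.
have /natrP[n nE] : N \is a Num.nat.
  apply: rpred_sum => i _; apply: rpredM; first exact: rpred_nat.
  by rewrite natrEint f_int ltW.
have /intrP[e dE] := f_int x.
have [c c_neq0 adjE] := adj_FP.
have Qd_gt0 := reduced_char_poly_gt0.
have QdE := horner_reduced_char_poly adjE.
have c_gt0 : 0 < c by move: Qd_gt0; rewrite QdE pmulr_lgt0 // FPdim_ring_gt0.
pose u k := \adj (e%:M - zmulmx B x) (zone B) k.
have uE k : (u k)%:~R = c * (p k)%:R :> R.
  have /matrixP/(_ (zone B) k) := adjE.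
  rewrite dE -map_scalar_mx -map_mxB -map_mx_adj mxE => ->.
  by rewrite !mxE big_ord1 !mxE zone1 rmorph1 mul1r.
have u_ge0 k : 0 <= u k by rewrite -(ler0z R) uE mulr_ge0 // ltW.
pose a k := `|u k|%N.
have aE k : (a k)%:R = c * (p k)%:R :> R by rewrite -uE -(gez0_abs (u_ge0 k)).
have [p_gt0 gcd_p _] := p_FP.
(* c = a_0 / p_0, and p_0 divides every a_0 p_k = a_k p_0, hence a_0. *)
have : (p (zone B) %| a (zone B))%N.
  rewrite -[a _]muln1 -gcd_p (big_morph (muln _) (muln_gcdr _) (muln0 _)).
  apply/dvdn_biggcdP=> k _; apply/dvdnP; exists (a k).
  by apply/eqP; rewrite -(eqr_nat R) !natrM !aE; apply/eqP; ring.
move=> /dvdnP[q aq].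
have cE : c = q%:R.
  apply: (@mulIf _ (p (zone B))%:R); first by rewrite pnatr_eq0 -lt0n.
  by rewrite -aE aq natrM.
exists n, (q * n)%N; split=> //; last exact: dvdn_mull.
  by rewrite QdE cE nE natrM.
by rewrite -(ltr0n R) natrM -cE -nE -QdE.
Qed.

End FrobeniusPerron.

(** * Elementary inequalities *)

(** By Bernoulli, (1 + 1/k)^k >= 2, so (k+1)^(k+1) >= 2 (k+1) k^k. *)
Lemma self_exp_leS (k r : nat) : (r <= k.*2.+1)%N ->
  (k ^ k * r <= k.+1 ^ k.+1)%N.
Proof.
move=> r_le; case: k => [|k] in r_le *; first by rewrite expn0 mul1n exp1n.
have bernoulli : (k.+1 ^ k.+1 * 2 <= k.+2 ^ k.+1)%N.
  rewrite -[k.+2]addn1 expnDn big_ord_recl subn0 bin0 mul1n exp1n muln1.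
  rewrite big_ord_recl /= /bump leq0n subSS subn0 bin1 exp1n muln1 -expnS.
  by rewrite muln2 -addnn leq_add2l leq_addr.
rewrite [leqRHS]expnSr; apply: leq_trans (_ : _ <= k.+1 ^ k.+1 * 2 * k.+2)%N _.
  by rewrite -mulnA leq_mul2l (leq_trans r_le) ?orbT // mul2n; lia.
by rewrite leq_mul2r bernoulli orbT.
Qed.

(** The step from k to k + 1 holds exactly when k^k r <= (k+1)^(k+1), which is
    guaranteed as soon as r <= 2 k + 1. *)
Lemma ratio_exp_le (F : realFieldType) (r c0 c : nat) :
  (0 < r)%N -> (r <= c0.*2.+1)%N -> (c0 <= c)%N ->
  (c0%:R / r%:R : F) ^+ c0 <= (c%:R / r%:R) ^+ c.
Proof.
move=> r_gt0 r_le /subnKC <-; elim: (c - c0)%N => [|m IH].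
  by rewrite addn0.
apply: le_trans IH _; rewrite addnS; set k := (c0 + m)%N.
rewrite !expr_div_n ler_pdivlMr ?exprn_gt0 ?ltr0n // [r%:R ^+ _.+1]exprS.
rewrite mulrCA divfK ?expf_neq0 ?pnatr_eq0 -?lt0n //.
rewrite -!natrX -natrM ler_nat mulnC self_exp_leS // /k; lia.
Qed.

(** For odd n the ratio on the right is 1/2 with a smaller exponent; for n = 2 h
    the claim is (1/4)^h <= (h / (2 h + 1))^h. *)
Lemma half_exp_le (F : realFieldType) (n : nat) : (0 < n)%N ->
  (1 / 2 : F) ^+ n <= ((uphalf n)%:R / n.+1%:R) ^+ uphalf n.
Proof.
move=> n_gt0; rewrite -{1}(odd_double_half n) uphalf_half.
case: (boolP (odd n)) => n_odd.
  have -> : n.+1 = ((true + n./2) * 2)%N.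
    by rewrite -{1}(odd_double_half n) n_odd muln2 doubleD.
  rewrite natrM invfM mulrA divff ?pnatr_eq0 // -addnn addnA exprD.
  by rewrite ler_piMr ?exprn_ge0 ?exprn_ile1 //; lra.
rewrite !add0n -mul2n exprM lerXn2r ?nnegrE ?divr_ge0 ?exprn_ge0 //; first lra.
rewrite ler_pdivlMr ?ltr0n //.
have nE : n = n./2.*2 by rewrite -{1}(odd_double_half n) (negbTE n_odd).
have -> : n.+1 = (n./2 * 2 + 1)%N by rewrite {1}nE muln2 addn1.
have : (1 : F) <= (n./2)%:R by rewrite ler1n; lia.
by rewrite natrD natrM; lra.
Qed.

Lemma powR_root_le (R : realType) (n c : nat) (y a d : R) :
  (0 < n)%N -> 0 <= y -> 0 <= a -> 0 <= d -> y * a ^+ c <= d ^+ n ->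
  y `^ (1 / n%:R) * a `^ (c%:R / n%:R) <= d.
Proof.
move=> n_gt0 y_ge0 a_ge0 d_ge0 yad.
have dE : (d ^+ n) `^ (1 / n%:R) = d.
  rewrite -powR_mulrn // -powRrM mul1r divff ?powRr1 //.
  by rewrite pnatr_eq0 -lt0n.
have -> : c%:R / n%:R = c%:R * (1 / n%:R) :> R by rewrite mul1r.
rewrite [a `^ _]powRrM powR_mulrn // -powRM ?exprn_ge0 //.
rewrite -[leRHS]dE; apply: ge0_ler_powR => //.
- by rewrite divr_ge0.
- by rewrite nnegrE mulr_ge0 // exprn_ge0.
- by rewrite nnegrE exprn_ge0.
Qed.

(** * The lower bound for the dimension of a generator *)

Theorem theorem3p1 (R : realType) (A : pzRingType) (r : nat)
    (B : zplus_ring A r) (FPdim : {rmorphism A -> R}) (p m : 'I_r -> nat)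
    (hr : (1 < r)%N)
    (hFP : is_FPdim B FPdim)
    (hint : integral_FPdim FPdim)
    (hp : is_FPvector B FPdim p)
    (hgen : zplus_generator B (\sum_(i < r) zbasis B i *+ m i)) :
  let b := \sum_(i < r) zbasis B i *+ m i in
  let d := FPdim b in
  let N := FPdim_ring B FPdim p in
  let Q := reduced_char_poly B b d in
  let s := num_upper_roots Q in
  let c := uphalf r.-1 in
  [/\ (exists n q : nat,
         [/\ N = n%:R, Q.[d] = q%:R, (0 < q)%N & (n %| q)%N])
      /\ N <= Q.[d],
      N `^ (1 / (r.-1)%:R)
        * (1 - (s.+1)%:R / r%:R) `^ (1 - s%:R / (r.-1)%:R) <= d
    & N `^ (1 / (r.-1)%:R) * (c%:R / r%:R) `^ (c%:R / (r.-1)%:R) <= d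
      /\ 1 / 2 * N `^ (1 / (r.-1)%:R) <= d ].
Proof.
move=> b d N Q s c.
have b_ge0 i : 0 <= zcoord B b i.
  by rewrite (zcoordK B (fun j => (m j)%:Z)).
have r1_gt0 : (0 < r.-1)%N by rewrite -ltnS prednK // ltnW.
have r_neq0 : r%:R != 0 :> R by rewrite pnatr_eq0 -lt0n ltnW.
have r1_neq0 : r.-1%:R != 0 :> R by rewrite pnatr_eq0 -lt0n.
have d_ge0 : 0 <= d := FPdim_ge0 hFP b_ge0.
have N_ge0 : 0 <= N := ltW (FPdim_ring_gt0 hFP hp).
have [n [q [nE qE q_gt0 nq]]] :=
  FPdim_ring_dvd_reduced_char_poly hFP hp b_ge0 hgen hint.
have NQ : N <= Q.[d] by rewrite /N /Q nE qE ler_nat dvdn_leq.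
have s_le : (s.*2 <= r.-1)%N := double_upper_roots_le b hFP.
have sc : (s + (r.-1 - s) = r.-1)%N by lia.
have c'_gt0 : (0 < r.-1 - s)%N by lia.
have := reduced_char_poly_le hFP hp b_ge0 hgen (erefl s) sc c'_gt0.
move: sc c'_gt0; set c' := (r.-1 - s)%N => sc c'_gt0 Qd_le.
have Nd_le : N * (c'%:R / r%:R) ^+ c' <= d ^+ r.-1.
  by apply: le_trans Qd_le; rewrite ler_wpM2r // exprn_ge0 // divr_ge0.
have cc' : (c <= c')%N by rewrite /c /c' uphalf_half; lia.
have r_le : (r <= c.*2.+1)%N by rewrite /c uphalf_half; lia.
have Nd_le_c : N * (c%:R / r%:R) ^+ c <= d ^+ r.-1.
  by apply: le_trans Nd_le; rewrite ler_wpM2l // ratio_exp_le // ltnW.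
split; first by split=> //; exists n, q.
- have r1E : r.-1%:R = s%:R + c'%:R :> R by rewrite -sc natrD.
  have rE : r%:R = s.+1%:R + c'%:R :> R.
    by rewrite -natrD addSn sc prednK // ltnW.
  have -> : 1 - s.+1%:R / r%:R = c'%:R / r%:R :> R.
    by rewrite -{1}(divff r_neq0) -mulrBl {1}rE addrAC subrr add0r.
  have -> : 1 - s%:R / r.-1%:R = c'%:R / r.-1%:R :> R.
    by rewrite -{1}(divff r1_neq0) -mulrBl {1}r1E addrAC subrr add0r.
  by apply: powR_root_le => //; rewrite divr_ge0.
split; first by apply: powR_root_le => //; rewrite divr_ge0.
(* With both exponents equal to r - 1, the factor (1/2)^((r-1)/(r-1)) is 1/2. *)
have := @powR_root_le R r.-1 r.-1 N (1 / 2) d r1_gt0 N_ge0.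
rewrite divff // powRr1 ?divr_ge0 // => root_le.
rewrite mulrC; apply: root_le => //.
apply: le_trans Nd_le_c; rewrite ler_wpM2l //.
by have := half_exp_le R r1_gt0; rewrite prednK // ltnW.
Qed.
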